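(* There exists $n_0$ such that the following holds for every even integer $n \ge n_0$. If $\mathcal{F}$ is a maximal $3$-wise intersecting family of subsets of $[n]=\{1,\ldots,n\}$ with $|\mathcal{F}| \le 2^{(n+2)/2}-3$, then $\mathcal{F}$ is a balanced pair of linked cubes.
   Context: A family $\mathcal{F}$ of subsets of $[n]$ is $k$-wise intersecting if every collection of at most $k$ members of $\mathcal{F}$ has a common element; it is maximal $k$-wise intersecting if moreover no subset of $[n]$ outside $\mathcal{F}$ can be added to $\mathcal{F}$ while preserving this property. A pair of linked cubes is a family of the form $\{A : S \subsetneq A \subseteq [n]\} \cup \{B : [n]\setminus S \subsetneq B \subseteq [n]\}$ for some $S \subseteq [n]$; it is balanced if $\lfloor n/2\rfloor \le |S| \le \lceil n/2 \rceil$. *)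

(* Defs.v *)
From mathcomp Require Import all_boot.
Set Implicit Arguments. Unset Strict Implicit. Unset Printing Implicit Defensive.

Definition kwise_intersecting (n k : nat) (F : {set {set 'I_n}}) : Prop :=
  forall G : {set {set 'I_n}}, G \subset F -> #|G| <= k ->
    exists x : 'I_n, forall A, A \in G -> x \in A.

Definition maximal_kwise_intersecting (n k : nat) (F : {set {set 'I_n}}) : Prop :=
  kwise_intersecting k F /\
  forall A : {set 'I_n}, A \notin F -> ~ kwise_intersecting k (A |: F).

Definition linked_cubes (n : nat) (S : {set 'I_n}) : {set {set 'I_n}} :=
  [set A : {set 'I_n} | S \proper A] :|: [set B : {set 'I_n} | ~: S \proper B].

Definition balanced_linked_cubes (n : nat) (F : {set {set 'I_n}}) : Prop :=
  exists S : {set 'I_n}, n./2 <= #|S| <= uphalf n /\ F = linked_cubes S.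

(* Main.v *)
Require Import Defs.
From mathcomp Require Import all_boot zify.
Set Implicit Arguments. Unset Strict Implicit. Unset Printing Implicit Defensive.

(** Let G be the family of complements of members of F and M = 2 ^ (n / 2), so
    that |G| < 2 M. By maximality G is a down-set and every set outside F is a
    disjoint union of two members of G; hence about half of the ordered pairs in
    G x G are disjoint. Disjoint triples are rare: the disjoint triples of
    unions of 8 random members of G are controlled from below by
    Cauchy-Schwarz, while one of three pairwise disjoint unions has at most n/3
    points, which for 8 random members of G has exponentially small
    probability. So the disjointness graph on G is dense and almost
    triangle-free, and it is within a polynomially small fraction of a complete
    bipartite graph with parts A and B of size about M. A point can be in
    a sizeable fraction of A or of B but not of both, so almost all of A lies in
    the power set of some S and almost all of B in the power set of its
    complement, with |S| = n / 2. Finally let u >= v be the numbers of subsets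
    of S and of its complement missing from G (up to exchanging the two), and w
    the number of members of G meeting both; the size of G gives w + 2 <= u + v,
    and counting representations of the u M sets with missing trace on S gives
    u M <= M + w + 2 u + u w + w ^ 2, which forces u = v = 1 and w = 0. *)

(** * Cauchy-Schwarz with weights, over the natural numbers *)

Lemma weighted_cauchy_schwarz (I : finType) (b c : I -> nat) :
  (\sum_i b i * c i) ^ 2 <= (\sum_i b i) * (\sum_i b i * c i ^ 2).
Proof.
have sq (f g : I -> nat) :
    (\sum_i f i) * (\sum_i g i) = \sum_i \sum_j f i * g j.
  by rewrite big_distrl; apply: eq_bigr => i _; rewrite big_distrr.
(* Once doubled and symmetrised, both sides compare term by term over ordered pairs, by
   [2 * (c i * c j) <= c i ^ 2 + c j ^ 2]. *)
rewrite -(leq_pmul2l (isT : 0 < 2)) -mulnn sq.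
rewrite [X in _ <= X]mul2n -addnn {2}[(\sum_i b i) * _]mulnC !sq -!big_split.
rewrite big_distrr /=.
apply: leq_sum => i _; rewrite -big_split big_distrr /=; apply: leq_sum => j _.
have [/(leq_mul (leqnn (b i * b j))) + _] := nat_Cauchy (c i) (c j).
by rewrite -!mulnn; lia.
Qed.

Lemma card_set_type (X : finType) : #|{set X}| = 2 ^ #|X|.
Proof. by rewrite -(cardsT X) -card_powerset powersetT cardsT. Qed.

(** * Disjoint triples and unions of random sets *)

Section UnionConvolution.

Variable X : finType.
Implicit Types (U V W : {set X}) (a b c : {set X} -> nat).

Definition mass a := \sum_U a U.

(** Up to normalisation, the law of the union of two independent random sets with laws [a] and
    [b]. *)
Definition uconv a b U := \sum_V \sum_(W | V :|: W == U) a V * b W.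

(** The zeta transform of the subset lattice; it turns [uconv] into a product, as a union lies in
    [U] exactly when both its parts do. *)
Definition below a U := \sum_(V : {set X} | V \subset U) a V.

Definition disjoint_triples a b c :=
  \sum_U \sum_V \sum_W a U * b V * c W *
    ([disjoint U & V] * [disjoint V & W] * [disjoint W & U]).

Lemma sum_uconv a b (f : {set X} -> nat) :
  \sum_U uconv a b U * f U = \sum_V \sum_W a V * b W * f (V :|: W).
Proof.
under eq_bigr => U _ do rewrite /uconv big_distrl /=.
rewrite exchange_big; apply: eq_bigr => V _.
under eq_bigr => U _ do rewrite big_distrl /=.
rewrite (exchange_big_dep xpredT) //=; apply: eq_bigr => W _.
by rewrite (big_pred1 (V :|: W)) // => U; rewrite eq_sym.
Qed.

Lemma mass_uconv a b : mass (uconv a b) = mass a * mass b.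
Proof.
have := sum_uconv a b (fun=> 1).
rewrite /mass; under eq_bigr do rewrite muln1.
move=> ->; rewrite big_distrl; apply: eq_bigr => V _.
by rewrite big_distrr; apply: eq_bigr => W _; rewrite /= muln1.
Qed.

Lemma belowE a U : below a U = \sum_V a V * (V \subset U).
Proof. by rewrite /below big_mkcond; apply: eq_bigr => V _; case: ifP; lia. Qed.

Lemma below_uconv a b U : below (uconv a b) U = below a U * below b U.
Proof.
rewrite !belowE (sum_uconv a b (fun V => nat_of_bool (V \subset U))).
rewrite big_distrl; apply: eq_bigr => V _.
rewrite big_distrr; apply: eq_bigr => W _ /=.
by rewrite subUset; do 2!case: (_ \subset U); rewrite ?muln1 ?muln0.
Qed.

Lemma disjoint_triplesC a b c :
  disjoint_triples a b c = disjoint_triples b c a.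
Proof.
rewrite /disjoint_triples exchange_big; apply: eq_bigr => V _ /=.
rewrite exchange_big; apply: eq_bigr => W _ /=.
by apply: eq_bigr => U _; lia.
Qed.

(** Cauchy-Schwarz over the disjoint pairs [(V, W)]: squaring the inner sum takes two copies of [U],
    and both are disjoint from [V] and [W] exactly when their union is. *)
Lemma disjoint_triples_sqr a b c :
  disjoint_triples a b c ^ 2 <=
    mass b * mass c * disjoint_triples (uconv a a) b c.
Proof.
pose w (p : {set X} * {set X}) := b p.1 * c p.2 * [disjoint p.1 & p.2].
pose k (p : {set X} * {set X}) U : nat := [disjoint U & p.1] * [disjoint p.2 & U].
have triE a' : disjoint_triples a' b c = \sum_p w p * \sum_U a' U * k p U.
  rewrite /disjoint_triples.
  under eq_bigr => U _ do rewrite pair_big /=.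
  rewrite exchange_big; apply: eq_bigr => -[V W] _ /=.
  by rewrite big_distrr; apply: eq_bigr => U _; rewrite /w /k /=; lia.
have kU p U V : k p (U :|: V) = k p U * k p V.
  rewrite /k -!setI_eq0 setIUl setIUr !setU_eq0 -!mulnb; lia.
rewrite !triE; apply: leq_trans (weighted_cauchy_schwarz _ _) _.
apply: leq_mul.
  rewrite /mass big_distrl /= -[X in _ <= X]/(\sum_U _).
  under [X in _ <= X]eq_bigr => U _ do rewrite big_distrr.
  rewrite pair_big; apply: leq_sum => -[V W] _ /=.
  by rewrite /w /=; case: [disjoint _ & _]; lia.
apply: leq_sum => p _; rewrite leq_mul2l sum_uconv; apply/orP; right.
rewrite -mulnn big_distrl; apply: leq_sum => U _.
rewrite big_distrr; apply: leq_sum => V _ /=; rewrite kU; lia.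
Qed.

Definition uconv8 a := iter 3 (fun b => uconv b b) a.

Lemma mass_uconv8 a : mass (uconv8 a) = mass a ^ 8.
Proof. by rewrite /= !mass_uconv !mulnn -!expnM. Qed.

Lemma below_uconv8 a U : below (uconv8 a) U = below a U ^ 8.
Proof. by rewrite /= !below_uconv !mulnn -!expnM. Qed.

Lemma disjoint_triples_pow8 a b c :
  disjoint_triples a b c ^ 8 <=
    (mass b * mass c) ^ 7 * disjoint_triples (uconv8 a) b c.
Proof.
have dbl := disjoint_triples_sqr _ b c.
have -> : disjoint_triples a b c ^ 8 = ((disjoint_triples a b c ^ 2) ^ 2) ^ 2.
  by rewrite -!expnM.
apply: (@leq_trans ((mass b * mass c) ^ 4 *
  (disjoint_triples (uconv a a) b c ^ 2) ^ 2)).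
  by rewrite [(mass b * _) ^ 4](expnM _ 2 2) -!expnMn !leq_exp2r.
apply: (@leq_trans ((mass b * mass c) ^ 6 *
  disjoint_triples (iter 2 (fun b => uconv b b) a) b c ^ 2)).
  by rewrite (expnD _ 4 2) -mulnA leq_mul2l -expnMn leq_exp2r ?dbl ?orbT.
by rewrite (expnD _ 6 1) expn1 -mulnA leq_mul2l dbl orbT.
Qed.

(** The 8th power bound is applied to each argument in turn, whence 512 = 8 ^ 3. The exponents 14,
    63, 112 are 7 times the total degree of the two idle arguments, and 1512 = 14 * 64 + 63 * 8 +
    112. *)
Lemma disjoint_triples_pow512 a :
  disjoint_triples a a a ^ 512 <=
    mass a ^ 1512 * disjoint_triples (uconv8 a) (uconv8 a) (uconv8 a).
Proof.
set a8 := uconv8 a; set m := mass a.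
have h1 : disjoint_triples a a a ^ 8 <= m ^ 14 * disjoint_triples a a a8.
  rewrite -disjoint_triplesC (expnM _ 2 7) -mulnn.
  exact: disjoint_triples_pow8.
have h2 : disjoint_triples a a a8 ^ 8 <= m ^ 63 * disjoint_triples a a8 a8.
  rewrite -[disjoint_triples a a8 a8]disjoint_triplesC (expnM _ 9 7).
  by rewrite (expnD _ 1 8) expn1 -(mass_uconv8 a); exact: disjoint_triples_pow8.
have h3 : disjoint_triples a a8 a8 ^ 8 <= m ^ 112 * disjoint_triples a8 a8 a8.
  rewrite (expnM _ 16 7) (expnD _ 8 8) -(mass_uconv8 a).
  exact: disjoint_triples_pow8.
rewrite (expnM _ 64 8) (expnM _ 8 8).
apply: (@leq_trans (((m ^ 14 * disjoint_triples a a a8) ^ 8) ^ 8)).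
  by rewrite !leq_exp2r.
rewrite (expnMn (m ^ 14) _ 8) (expnMn ((m ^ 14) ^ 8) _ 8).
apply: (@leq_trans (((m ^ 14) ^ 8) ^ 8 * (m ^ 63 * disjoint_triples a a8 a8) ^ 8)).
  by rewrite leq_mul2l leq_exp2r ?h2 ?orbT.
rewrite (expnMn (m ^ 63) _ 8) mulnA -!expnM -expnD.
by rewrite (expnD _ 1400 112) -mulnA leq_mul2l h3 orbT.
Qed.

(** Among three pairwise disjoint sets one has at most a third of the points. *)
Lemma disjoint_triples_small a :
  disjoint_triples a a a <=
    3 * (mass a ^ 2 * \sum_(U : {set X} | 3 * #|U| <= #|X|) a U).
Proof.
pose s U : nat := 3 * #|U| <= #|X|.
have small U V W : [disjoint U & V] * [disjoint V & W] * [disjoint W & U] <=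
    s U + s V + s W.
  case: (boolP [disjoint U & V]) => // dUV.
  case: (boolP [disjoint V & W]) => // dVW.
  case: (boolP [disjoint W & U]) => // dWU.
  have : #|U :|: V :|: W| <= #|X| by exact: max_card.
  rewrite !cardsU setIUl.
  move: dUV dVW dWU; rewrite -!setI_eq0 => /eqP -> /eqP ->; rewrite setIC => /eqP ->.
  by rewrite setU0 !cards0 /s; lia.
have sumE (f g h : {set X} -> nat) : \sum_U \sum_V \sum_W f U * g V * h W =
    (\sum_U f U) * (\sum_U g U) * (\sum_U h U).
  rewrite -mulnA big_distrl; apply: eq_bigr => U _ /=.
  rewrite big_distrl big_distrr; apply: eq_bigr => V _ /=.
  by rewrite !big_distrr; apply: eq_bigr => W _ /=; rewrite mulnA.
pose as_ U := a U * s U.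
have -> : \sum_(U : {set X} | 3 * #|U| <= #|X|) a U = \sum_U as_ U.
  by rewrite big_mkcond; apply: eq_bigr => U _; rewrite /as_ /s; case: ifP; lia.
have -> : 3 * (mass a ^ 2 * \sum_U as_ U) = 
    \sum_U \sum_V \sum_W as_ U * a V * a W +
    \sum_U \sum_V \sum_W a U * as_ V * a W +
    \sum_U \sum_V \sum_W a U * a V * as_ W.
  by rewrite !sumE -/(mass a) -mulnn; lia.
rewrite -!big_split; apply: leq_sum => U _ /=.
rewrite -!big_split; apply: leq_sum => V _ /=.
rewrite -!big_split; apply: leq_sum => W _ /=.
apply: leq_trans (leq_mul (leqnn _) (small U V W)) _.
by rewrite /as_; lia.
Qed.

Lemma disjoint_triples_bound a : (forall U, a U <= 1) ->
  disjoint_triples a a a ^ 512 <=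
    3 * mass a ^ 1528 * 2 ^ (#|X| + 8 * (#|X| %/ 3)).
Proof.
move=> a1; apply: leq_trans (disjoint_triples_pow512 a) _.
rewrite (expnD _ 1512 16).
have regroup p q r : 3 * (p * q) * r = p * (3 * (q * r)) by lia.
rewrite regroup leq_mul2l; apply/orP; right.
apply: leq_trans (disjoint_triples_small _) _.
rewrite mass_uconv8 -expnM leq_mul2l /= leq_mul2l; apply/orP; right.
(* A union of 8 sets equal to a small [U] forces all 8 inside [U], leaving at most [(2 ^ #|U|) ^ 8]
   choices. *)
apply: (@leq_trans (\sum_(U : {set X}) 2 ^ (8 * (#|X| %/ 3)))).
  rewrite big_mkcond; apply: leq_sum => U _; case: ifP => // sU.
  apply: (@leq_trans (below (uconv8 a) U)).
    by rewrite /below (bigD1 U) //= leq_addr.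
  rewrite below_uconv8 mulnC expnM leq_exp2r //.
  apply: (@leq_trans (\sum_(V | V \in powerset U) 1)).
    rewrite /below; under [X in _ <= X]eq_bigl => V do rewrite powersetE.
    by apply: leq_sum.
  by rewrite sum1_card card_powerset leq_exp2l // leq_divRL // mulnC.
by rewrite sum_nat_const card_set_type expnD.
Qed.

(** Eight of the factors [mass a] give at least [2 ^ (4 * #|X|)], which beats
    [2 ^ (#|X| + 8 * (#|X| %/ 3))] by at least [2 ^ (#|X| %/ 3)]; this surplus pays for
    [3 * q ^ 512]. *)
Lemma few_disjoint_triples a q : (forall U, a U <= 1) ->
    2 ^ #|X| <= mass a ^ 2 -> 3 * q ^ 512 <= 2 ^ (#|X| %/ 3) ->
  disjoint_triples a a a * q <= mass a ^ 3.
Proof.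
move=> a1 lbm lbq; rewrite leqNgt; apply/negP => big.
set t := disjoint_triples a a a in big; set m := mass a in lbm big.
have m0 : 0 < m by case: m lbm {big} => //; rewrite leqNgt expn_gt0.
have lbm8 : 2 ^ (4 * #|X|) <= m ^ 8.
  by rewrite mulnC expnM (expnM _ 2 4) leq_exp2r.
have ub : t ^ 512 * 2 ^ (#|X| %/ 3) <= 3 * m ^ 1536.
  have := disjoint_triples_bound a1; rewrite -/t -/m (expnD m 1528 8).
  have : 2 ^ (#|X| + 8 * (#|X| %/ 3)) * 2 ^ (#|X| %/ 3) <= m ^ 8.
    by apply: leq_trans lbm8; rewrite -expnD leq_exp2l //; clear; lia.
  move: (t ^ 512) (m ^ 1528) (m ^ 8) (2 ^ (_ + _)) => x y z v.
  move: (2 ^ _) => w vw tx.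
  apply: leq_trans (leq_mul tx (leqnn w)) _.
  by rewrite -!mulnA !leq_mul2l vw orbT.
have lb : m ^ 1536 < t ^ 512 * q ^ 512.
  by rewrite -expnMn (expnM _ 3 512) ltn_exp2r.
have := leq_mul (leqnn (t ^ 512)) lbq.
move: (t ^ 512) (m ^ 1536) (q ^ 512) (2 ^ _) ub lb; clear; lia.
Qed.

End UnionConvolution.

(** * Dense cuts in almost triangle-free graphs *)

Section Cut.

Variables (I : finType) (r : rel I) (G : {set I}).

Definition edges (A B : {set I}) := \sum_(x in A) \sum_(y in B) r x y.

Definition triangles :=
  \sum_(x in G) \sum_(y in G) \sum_(z in G) r x y * r y z * r z x.

Hypothesis rC : symmetric r.

(* A is the neighbourhood of a vertex v; the sum over v of the degree sums over
   these neighbourhoods is the sum of the squared degrees. *)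
Lemma dense_cut : exists2 A : {set I}, A \subset G &
  edges G G ^ 2 <= #|G| ^ 2 * edges A (G :\: A) + #|G| * triangles.
Proof.
pose N v := [set a in G | r v a].
pose d x := \sum_(y in G) r x y.
pose t v := \sum_(y in G) \sum_(z in G) r v y * r y z * r z v.
have sN v (f : I -> nat) : \sum_(a in N v) f a = \sum_(a in G) r v a * f a.
  rewrite [LHS](eq_bigl (fun a => (a \in G) && r v a)); last first.
    by move=> a; rewrite inE.
  by rewrite big_mkcondr; apply: eq_bigr => a _; case: (r v a) => /=; lia.
have sC v (f : I -> nat) :
    \sum_(a in G :\: N v) f a = \sum_(a in G) (~~ r v a) * f a.
  rewrite [LHS](eq_bigl (fun a => (a \in G) && ~~ r v a)); last first.
    by move=> a; rewrite !inE; case: (a \in G); rewrite ?andbF ?andbT.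
  by rewrite big_mkcondr; apply: eq_bigr => a _; case: (r v a) => /=; lia.
(* An edge from a neighbour [a] of [v] to [b] either crosses the cut or closes a triangle [v], [a],
   [b]. *)
have cut v : edges (N v) (G :\: N v) + t v = \sum_(a in G) r v a * d a.
  rewrite /edges sN -big_split; apply: eq_bigr => a _ /=.
  rewrite sC big_distrr -big_split /d big_distrr; apply: eq_bigr => b _ /=.
  by rewrite [r b v]rC; case: (r v b); lia.
have sum_cut : \sum_(v in G) edges (N v) (G :\: N v) + triangles =
    \sum_(a in G) d a ^ 2.
  rewrite /triangles -big_split /=.
  under eq_bigr => v _ do rewrite -/(t v) cut.
  rewrite exchange_big; apply: eq_bigr => a _ /=.
  rewrite -big_distrl -mulnn /d /=; congr (_ * _).
  by apply: eq_bigr => v _; rewrite rC.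
have cs : edges G G ^ 2 <= #|G| * \sum_(a in G) d a ^ 2.
  have := weighted_cauchy_schwarz (fun x => nat_of_bool (x \in G)) d.
  have mem (f : I -> nat) : \sum_x (x \in G) * f x = \sum_(x in G) f x.
    by rewrite [RHS]big_mkcond; apply: eq_bigr => x _; case: ifP; lia.
  rewrite !mem; congr (_ <= _ * _).
  by rewrite -sum1_card -(mem (fun=> 1)); apply: eq_bigr => x _; rewrite muln1.
case: (boolP [exists v in G, edges G G ^ 2 <=
    #|G| ^ 2 * edges (N v) (G :\: N v) + #|G| * triangles]).
  case/existsP => v /andP[_ Hv]; exists (N v) => //.
  by apply/subsetP => a; rewrite inE => /andP[].
rewrite negb_exists => /forallP none.
have [G0|G_gt0] := posnP #|G|.
  exists set0; first exact: sub0set.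
  by rewrite (leq_trans cs) // G0.
have : \sum_(v in G) (#|G| ^ 2 * edges (N v) (G :\: N v) + #|G| * triangles).+1
    <= \sum_(v in G) edges G G ^ 2.
  by apply: leq_sum => v vG; have := none v; rewrite vG /= -ltnNge.
under eq_bigr => v _ do rewrite -addn1.
rewrite !big_split /= -big_distrr !sum_nat_const /=.
move: sum_cut cs; move: (\sum_(v in G) edges _ _) (\sum_(a in G) d a ^ 2) => x y.
move: (edges G G ^ 2) triangles #|G| G_gt0 => e q m m0.
rewrite -!mulnn; nia.
Qed.

End Cut.

(** * Localization of the two sides on complementary point sets *)

Lemma near_extremal_product M a b c : 0 < c -> a + b <= 2 * M ->
  (c * M) ^ 2 <= c ^ 2 * (a * b) + M ^ 2 -> c.-1 * M <= c * a.
Proof.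
case: c => // c _ ab prod; have [//|lt] := leqP; exfalso.
have aM : a < M by rewrite -(@ltn_pmul2l c.+1) // (leq_trans lt) // leq_mul2r leqnSn orbT.
move: (subnKC (ltnW aM)) => EM; set d := M - a in EM.
(* With [a = M - d] the product loses [d ^ 2], more than [prod] allows, since [lt] makes [d] exceed
   [M / c.+1]. *)
have sq : a * b + d ^ 2 <= M ^ 2.
  have : b <= a + 2 * d by lia.
  by move/(leq_mul (leqnn a)); rewrite -EM -!mulnn; lia.
have Mcd : M < c.+1 * d by move: lt; rewrite -EM /=; lia.
move: Mcd; rewrite -(@ltn_exp2r _ _ 2) // expnMn => Mcd.
move: prod; rewrite expnMn; move/(leq_trans (leq_mul (leqnn _) sq)).
by rewrite mulnDr leq_add2l leqNgt Mcd.
Qed.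

Section Localization.

Variable X : finType.
Implicit Types (A B : {set {set X}}) (S D : {set X}).

Definition disj : rel {set X} := fun D E => [disjoint D & E].

Definition deg A x := \sum_(D in A) (x \in D).

Definition inside A S := [set D in A | D \subset S].

Lemma card_inside_leq A S : #|inside A S| <= 2 ^ #|S|.
Proof.
rewrite -card_powerset; apply: subset_leq_card; apply/subsetP => D.
by rewrite !inE => /andP[].
Qed.

(** Pairs whose two members both contain [x] are not disjoint. *)
Lemma deg_mul_edges A B x : deg A x * deg B x + edges disj A B <= #|A| * #|B|.
Proof.
rewrite -!sum1_card /deg /edges !big_distrl -big_split; apply: leq_sum => D _ /=.
rewrite !big_distrr -big_split; apply: leq_sum => E _ /=; rewrite /disj.
case: (boolP [disjoint D & E]) => [dDE|_]; last by do 2!case: (_ \in _).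
by case: (boolP (x \in D)) => // xD; rewrite (disjointFr dDE xD).
Qed.

Lemma card_inside_deg A S : #|A| <= #|inside A S| + \sum_(x in ~: S) deg A x.
Proof.
rewrite exchange_big -sum1_card -[#|inside A S|]sum1_card.
rewrite [\sum_(D in inside A S) 1](eq_bigl (fun D => (D \in A) && (D \subset S)));
  last by move=> D; rewrite inE.
rewrite big_mkcondr -big_split; apply: leq_sum => D _ /=.
case: ifP => // /negbT /subsetPn[x xD xS].
by rewrite (bigD1 x) ?inE //= xD.
Qed.

(** Union bound: a member leaving [S] contains a light point, and the light points together account
    for at most [M / c] members. *)
Lemma card_inside_heavy A S c M : 0 < #|X| ->
    (forall x, x \notin S -> deg A x * (c * #|X|) <= M) ->
  c * #|A| <= c * #|inside A S| + M.
Proof.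
move=> X0 light; rewrite -(leq_pmul2r X0).
have : \sum_(x in ~: S) deg A x * (c * #|X|) <= #|X| * M.
  apply: leq_trans (_ : \sum_(x in ~: S) M <= _).
    by apply: leq_sum => x; rewrite inE => /light.
  by rewrite sum_nat_const leq_mul2r max_card orbT.
rewrite -big_distrl /=.
have /(leq_mul (leqnn (c * #|X|))) := card_inside_deg A S.
by move: (\sum_(x in _) _) #|X| #|A| #|inside A S|; clear; lia.
Qed.

Lemma localization k A B (M := 2 ^ k) (q := 32 * #|X|) :
    #|X| = k.*2 -> 0 < k -> #|A| + #|B| <= 2 * M ->
    q ^ 2 * M ^ 2 <= q ^ 2 * edges disj A B + M ^ 2 ->
  exists S : {set X}, [/\ #|S| = k, 15 * M <= 16 * #|inside A S| &
                          15 * M <= 16 * #|inside B (~: S)|].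
Proof.
move=> Xk k0 cAB dense.
have X0 : 0 < #|X| by rewrite Xk double_gt0.
have M0 : 0 < M by rewrite expn_gt0.
have AM : #|A| * #|B| <= M ^ 2.
  rewrite -(leq_pmul2l (isT : 0 < 4)); apply: leq_trans (nat_AGM2 _ _) _.
  by rewrite -[4]/(2 ^ 2) -expnMn leq_exp2r.
(* The points heavy for each side. A point heavy for both would create more than [M ^ 2 / q ^ 2]
   intersecting pairs, against [dense]. *)
pose SA := [set x | M < deg A x * q]; pose SB := [set x | M < deg B x * q].
have dS : SA \subset ~: SB.
  apply/subsetP => x; rewrite !inE -leqNgt => hA; rewrite leqNgt; apply/negP => hB.
  have /(leq_mul (leqnn (q ^ 2))) := leq_trans (deg_mul_edges A B x) AM.
  have : M ^ 2 < q ^ 2 * (deg A x * deg B x).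
    by have := ltn_mul hA hB; rewrite -!mulnn; lia.
  rewrite mulnDr => lt le; have := leq_trans le dense.
  by rewrite addnC leq_add2l leqNgt lt.
have hA : 32 * #|A| <= 32 * #|inside A SA| + M.
  by apply: card_inside_heavy => // x; rewrite inE -leqNgt.
have hB : 32 * #|B| <= 32 * #|inside B SB| + M.
  by apply: card_inside_heavy => // x; rewrite inE -leqNgt.
have prod : (32 * M) ^ 2 <= 32 ^ 2 * (#|A| * #|B|) + M ^ 2.
  have edgesAB : edges disj A B <= #|A| * #|B|.
    have [x _] := card_gt0P X0.
    by apply: leq_trans (deg_mul_edges A B x); rewrite leq_addl.
  have q32 : 32 ^ 2 <= q ^ 2 by rewrite leq_exp2r // leq_pmulr.
  have {dense}: q ^ 2 * (M ^ 2 - #|A| * #|B|) <= M ^ 2.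
    rewrite mulnBr leq_subLR; apply: leq_trans dense _.
    by rewrite leq_add2r leq_mul2l edgesAB orbT.
  move/(leq_trans (leq_mul q32 (leqnn _))).
  by rewrite mulnBr leq_subLR expnMn.
have lbA : 31 * M <= 32 * #|A| by apply: near_extremal_product prod.
have lbB : 31 * M <= 32 * #|B|.
  apply: (@near_extremal_product M #|B| #|A| 32) => //; first by rewrite addnC.
  by rewrite [#|B| * _]mulnC.
(* A heavy set with fewer than [k] points has at most [M / 2] subsets, too few to hold nearly all of
   [C]. As [#|X|] is [2k], the disjoint [SA] and [SB] are then complementary. *)
have large (C : {set {set X}}) (S : {set X}) :
    32 * #|C| <= 32 * #|inside C S| + M -> 31 * M <= 32 * #|C| -> k <= #|S|.
  move=> hC lbC; rewrite leqNgt; apply/negP => Sk.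
  have : 2 * #|inside C S| <= M.
    apply: leq_trans (leq_mul (leqnn 2) (card_inside_leq C S)) _.
    by rewrite -expnS leq_exp2l.
  by clear -M0 hC lbC; lia.
have kA := large _ _ hA lbA; have kB := large _ _ hB lbB.
have SAB : #|SA| + #|SB| <= k.*2.
  by rewrite -Xk -(cardsC SB) addnC leq_add2l subset_leq_card.
have SAk : #|SA| = k by lia.
have SBk : #|SB| = k by lia.
have SBE : SB = ~: SA.
  apply/eqP; rewrite eqEcard -[SB]setCK setCS dS /=.
  by rewrite setCK SBk -(leq_add2l #|SA|) cardsC Xk SAk addnn.
exists SA; rewrite -SBE; split=> //.
  by clear -hA lbA; lia.
by clear -hB lbB; lia.
Qed.

End Localization.

(** * Exact structure from missing and crossing sets *)

Section Structure.

Variables (X : finType) (k : nat) (G : {set {set X}}).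
Implicit Types (D E P Q S Z : {set X}).

Hypothesis X_card : #|X| = k.*2.
Hypothesis k_large : 6 <= k.
Hypothesis G_down : forall D E, D \subset E -> E \in G -> D \in G.
Hypothesis G_cover : forall Z, ~: Z \notin G ->
  exists D E, [/\ D \in G, E \in G & Z = D :|: E].
Hypothesis G_small : #|G| + 3 <= 2 * 2 ^ k.

Definition missing S := powerset S :\: G.

Definition crossing S := [set D in G | ~~ (D \subset S) && ~~ (D \subset ~: S)].

Lemma crossingC S : crossing (~: S) = crossing S.
Proof. by apply/setP => D; rewrite !inE setCK [~~ _ && ~~ _]andbC. Qed.

Lemma card_missing S : #|missing S| + #|inside G S| = 2 ^ #|S|.
Proof.
rewrite -card_powerset addnC -(cardsID G (powerset S)); congr (_ + _).
by apply: eq_card => D; rewrite !inE andbC.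
Qed.

(** The extra 1 is the empty set, the only set inside both [S] and its complement. *)
Lemma card_crossing S :
  #|crossing S| + #|inside G S| + #|inside G (~: S)| <= #|G| + 1.
Proof.
have := cardsUI (inside G S) (inside G (~: S)).
have /subset_leq_card : inside G S :&: inside G (~: S) \subset [set set0].
  apply/subsetP => D; rewrite !inE => /andP[/andP[_ DS] /andP[_ DC]].
  by rewrite -subset0 -(setICr S) subsetI DS.
rewrite cards1 => I1 UI.
have := cardsID (inside G S :|: inside G (~: S)) G.
have -> : G :&: (inside G S :|: inside G (~: S)) = inside G S :|: inside G (~: S).
  by apply/setIidPr/subsetP => D; rewrite !inE => /orP[] /andP[].
have -> : G :\: (inside G S :|: inside G (~: S)) = crossing S.
  apply/setP => D; rewrite !inE; case: (D \in G); rewrite ?andbF ?andbT //=.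
  by rewrite negb_or.
by lia.
Qed.

(* Counts the sets Z with Z :&: S missing: Z is either the complement of a
   member of G, or a union of two members of G neither of which avoids S. *)
Lemma missing_bound S : #|S| = k ->
  #|missing S| * 2 ^ k <= 2 ^ k + #|crossing S| + 2 * #|missing S| +
    #|missing S| * #|crossing S| + #|crossing S| * #|crossing S|.
Proof.
move=> Sk; set u := #|missing S|; set w := #|crossing S|.
have SCk : #|~: S| = k by have := cardsC S; lia.
(* If [~: Z] is in [G], then [C1], [C2], [C3] cover the cases where it avoids [S], crosses, or lies
   in [S]. If [Z] is a union of two members, then [missing S], [C5], [C6] cover the cases where two,
   one or none of them lie in [S]. *)
pose C1 := [set S :|: Q | Q in powerset (~: S)].
pose C2 := [set ~: D | D in crossing S].
pose C3 := [set P :|: ~: S | P in missing S].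
pose C5 := [set p.1 :|: (p.2 :\: S) | p in setX (missing S) (crossing S)].
pose C6 := [set p.1 :|: p.2 | p in setX (crossing S) (crossing S)].
pose Zs := [set p.1 :|: p.2 | p in setX (missing S) (powerset (~: S))].
have Zs_card : #|Zs| = u * 2 ^ k.
  rewrite card_in_imset; first by rewrite cardsX card_powerset SCk.
  have split P Q : P \subset S -> Q \subset ~: S ->
      (P :|: Q) :&: S = P /\ (P :|: Q) :\: S = Q.
    move=> PS QS; rewrite setIUl setDUl (setIidPl PS).
    rewrite (_ : Q :&: S = set0); last by apply/eqP; rewrite setI_eq0 disjoints_subset.
    rewrite (_ : P :\: S = set0); last by apply/eqP; rewrite setD_eq0.
    by rewrite setU0 set0U setDE (setIidPl QS).
  move=> [P Q] [P' Q']; rewrite !inE /=.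
  move=> /andP[/andP[_ PS] QS] /andP[/andP[_ PS'] QS'] e.
  have [e1 e2] := split _ _ PS QS; have [e3 e4] := split _ _ PS' QS'.
  by rewrite e e3 in e1; rewrite e e4 in e2; rewrite e1 e2.
have cover : Zs \subset C1 :|: C2 :|: C3 :|: missing S :|: C5 :|: C6.
  apply/subsetP => Z /imsetP[[P Q] /setXP[/= PU]].
  rewrite powersetE => QS ->.
  have [PG PS] : P \notin G /\ P \subset S by move: PU; rewrite !inE => /andP[].
  have PE : (P :|: Q) :&: S = P.
    rewrite setIUl (setIidPl PS) (_ : Q :&: S = set0) ?setU0 //.
    by apply/eqP; rewrite setI_eq0 disjoints_subset.
  set Y := P :|: Q; have [ZG|ZG] := boolP (~: Y \in G).
    have [zS|zS] := boolP (~: Y \subset S).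
      apply/setUP; left; apply/setUP; left; apply/setUP; left; apply/setUP; right.
      apply/imsetP; exists P => //.
      apply/eqP; rewrite eqEsubset setUS //= subUset subsetUl /=.
      by rewrite -[Y]setCK setCS.
    have [zC|zC] := boolP (~: Y \subset ~: S).
      do 5!(apply/setUP; left); apply/imsetP; exists Q; rewrite ?powersetE //.
      by rewrite /Y; congr (_ :|: _); rewrite -PE; apply/setIidPr; rewrite -setCS.
    do 4!(apply/setUP; left); apply/setUP; right.
    by apply/imsetP; exists (~: Y); rewrite ?setCK // !inE ZG zS.
  have [D [E [DG EG YE]]] := G_cover ZG.
  (* If one member avoided [S], the trace [P] would lie in the other, hence in the down-set [G]. *)
  have half D' E' : D' \in G -> E' \in G -> Y = D' :|: E' ->
      ~~ (E' \subset ~: S).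
    move=> DG' EG' YE'; apply/negP => EC; case/negP: PG.
    rewrite -PE -/Y YE' setIUl (_ : E' :&: S = set0).
      by rewrite setU0; apply: G_down DG'; rewrite subsetIl.
    by apply/eqP; rewrite setI_eq0 disjoints_subset.
  have EC := half _ _ DG EG YE.
  have DC := half _ _ EG DG (etrans YE (setUC _ _)).
  have mixed D' E' : Y = D' :|: E' -> D' \subset S -> E' \in G ->
      ~~ (E' \subset S) -> ~~ (E' \subset ~: S) -> Y \in C5.
    move=> YE' DS' EG' ES' EC'; apply/imsetP; exists (P, E').
      by rewrite !inE /= PG PS EG' ES' EC'.
    rewrite /= -PE -/Y -[LHS](setID Y S); congr (_ :|: _).
    by rewrite YE' setDUl (_ : D' :\: S = set0) ?set0U //; apply/eqP; rewrite setD_eq0.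
  have [DS|DS] := boolP (D \subset S); have [ES|ES] := boolP (E \subset S).
  - do 2!(apply/setUP; left); apply/setUP; right.
    suff -> : Y = P by [].
    by rewrite -[RHS]PE -/Y; apply/esym/setIidPl; rewrite YE subUset DS.
  - by apply/setUP; left; apply/setUP; right; apply: (mixed D E).
  - apply/setUP; left; apply/setUP; right; apply: (mixed E D) => //.
    by rewrite setUC.
  - apply/setUP; right; apply/imsetP; exists (D, E) => //.
    by rewrite !inE /= DG EG DS DC ES EC.
rewrite -Zs_card; apply: leq_trans (subset_leq_card cover) _.
have bound (T : finType) (A : {set T}) (f : T -> {set X}) m :
  #|A| = m -> #|f @: A| <= m by move=> <-; exact: leq_imset_card.
have b1 : #|C1| <= 2 ^ k by apply: bound; rewrite card_powerset SCk.
have b2 : #|C2| <= w by apply: bound.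
have b3 : #|C3| <= u by apply: bound.
have b5 : #|C5| <= u * w by apply: bound; rewrite cardsX.
have b6 : #|C6| <= w * w by apply: bound; rewrite cardsX.
have cU (A B : {set {set X}}) : #|A :|: B| <= #|A| + #|B|.
  exact: leq_of_leqif (leq_card_setU A B).
have add (A B : {set {set X}}) a b :
    #|A| <= a -> #|B| <= b -> #|A :|: B| <= a + b.
  by move=> Aa Bb; apply: leq_trans (cU _ _) (leq_add Aa Bb).
rewrite mul2n -addnn addnA.
by do 5!(apply: (add); last by []).
Qed.

(** Write [u], [w] for the missing and crossing counts and [M = 2 ^ k]. As [w <= 2 * u - 2], the
    counting bound gives [(u - 1) * M <= 6 * u * (u - 1) + 2], while density gives [16 * u <= M]; so
    [u >= 2] is impossible. *)
Lemma missing_le1 S : #|S| = k -> 15 * 2 ^ k <= 16 * #|inside G S| ->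
    #|crossing S| + 2 <= #|missing S| + #|missing (~: S)| ->
    #|missing (~: S)| <= #|missing S| -> #|missing S| <= 1.
Proof.
move=> Sk dense w2 vu; have := missing_bound Sk; have := card_missing S.
rewrite Sk leqNgt => cM bnd; apply/negP => u2.
have M64 : 64 <= 2 ^ k by rewrite -[64]/(2 ^ 6) leq_exp2l.
move: (2 ^ k) #|missing S| #|missing (~: S)| #|inside G S| #|crossing S|
  M64 dense w2 vu cM bnd u2 => M u v i w; clear; nia.
Qed.

Lemma linked_cubes_structure S : #|S| = k ->
    15 * 2 ^ k <= 16 * #|inside G S| -> 15 * 2 ^ k <= 16 * #|inside G (~: S)| ->
  G = [set D : {set X} | D \proper S] :|: [set D : {set X} | D \proper ~: S].
Proof.
move=> Sk dS dC.
have SCk : #|~: S| = k by have := cardsC S; lia.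
have w2 : #|crossing S| + 2 <= #|missing S| + #|missing (~: S)|.
  have := card_missing S; have := card_missing (~: S); have := card_crossing S.
  by rewrite Sk SCk; move: (2 ^ k) G_small; lia.
have u1 : #|missing S| <= 1 /\ #|missing (~: S)| <= 1.
  have [vu|uv] := leqP #|missing (~: S)| #|missing S|.
    by have := missing_le1 Sk dS w2 vu; split=> //; lia.
  have : #|missing (~: S)| <= 1.
    by apply: missing_le1; rewrite ?crossingC ?setCK //; lia.
  by lia.
(* Since [G] is a down-set, any missing subset of [S'] makes [S'] missing too, so a single missing
   set must be [S']. *)
have top S' : #|missing S'| = 1 -> forall D, D \subset S' -> (D \in G) = (D != S').
  move/eqP/cards1P => [P MP] D DS.
  have : S' \in missing S'.
    have : P \in missing S' by rewrite MP set11.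
    rewrite !inE => /andP[PG PS]; rewrite subxx andbT.
    by apply: contra PG; exact: G_down.
  rewrite MP inE => /eqP eP; move/setP: MP => /(_ D).
  by rewrite !inE DS andbT eP => <-; rewrite negbK.
have uS : #|missing S| = 1 by lia.
have uC : #|missing (~: S)| = 1 by lia.
have w0 : crossing S = set0 by apply/eqP; rewrite -cards_eq0; lia.
apply/setP => D; rewrite !inE !properEneq.
have [DS|DS] := boolP (D \subset S).
  rewrite (top S) // andbT; have [DC|DC] := boolP (D \subset ~: S).
    case: eqVneq => //= eD; move: DC; rewrite eD -disjoints_subset -setI_eq0 setIid.
    by rewrite -cards_eq0 Sk; case: k k_large.
  by rewrite andbF orbF.
rewrite andbF /=; have [DC|DC] := boolP (D \subset ~: S).
  by rewrite andbT (top (~: S)).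
by rewrite andbF; move/setP: w0 => /(_ D); rewrite !inE DS DC; case: (D \in G).
Qed.

End Structure.

(** * Numerical estimates and assembly for down-sets *)

Lemma poly_leq_exp c d e : 0 < e ->
  exists n0, forall n, n0 <= n -> c * n ^ d <= 2 ^ (n %/ e).
Proof.
(* With [j = n %/ f], [n <= f * 2 ^ j] costs [d] factors [2 ^ j] and the constant [c * f ^ d] one
   more; [f] leaves room for exactly [d.+1]. *)
move=> e0; pose f := e * d.+1; have f0 : 0 < f by rewrite muln_gt0 e0.
exists (f * (c * f ^ d)) => n n_ge; pose j := n %/ f.
have j_ge : c * f ^ d <= 2 ^ j.
  by apply: leq_trans (ltnW (ltn_expl j (isT : 1 < 2))); rewrite leq_divRL // mulnC.
have n_le : n <= f * 2 ^ j.
  apply: ltnW; apply: (leq_trans (ltn_ceil n f0)).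
  by rewrite mulnC leq_mul2l ltn_expl ?orbT.
have e_le : j * d.+1 <= n %/ e.
  by rewrite leq_divRL // -mulnA [d.+1 * e]mulnC leq_divM.
apply: leq_trans (_ : 2 ^ (j * d.+1) <= _); last by rewrite leq_exp2l.
rewrite mulnS expnD expnM; apply: leq_trans (leq_mul j_ge (leqnn _)).
rewrite -mulnA -expnMn leq_mul2l; apply/orP; right.
by case: d @f f0 n_ge j j_ge n_le {e_le} => // d *; rewrite leq_exp2r.
Qed.

(** Every nonempty [Z] with [~: Z] outside [G] yields two ordered pairs, [(D, E)] and [(E, D)],
    distinct because disjoint sets with nonempty union differ. *)
Lemma edges_disj_lower (X : finType) (G : {set {set X}}) :
    (forall Z, ~: Z \notin G -> exists D E,
       [/\ D \in G, E \in G, [disjoint D & E] & Z = D :|: E]) ->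
  2 * 2 ^ #|X| <= edges (@disj X) G G + 2 * #|G| + 2.
Proof.
move=> cov.
pose P := [set p : {set X} * {set X} |
  [&& p.1 \in G, p.2 \in G & [disjoint p.1 & p.2]]].
have -> : edges (@disj X) G G = #|P|.
  rewrite /edges pair_big -sum1_card [RHS]big_mkcond [LHS]big_mkcond /=.
  apply: eq_bigr => p _; rewrite inE /disj.
  by do 2!case: (_ \in G) => //=; case: [disjoint _ & _].
pose N := ~: (set0 |: [set Z | ~: Z \in G]).
have N_card : 2 ^ #|X| <= #|N| + #|G| + 1.
  rewrite -card_set_type -(cardsC N) -addnA leq_add2l setCK.
  apply: leq_trans (leq_of_leqif (leq_card_setU _ _)) _; rewrite cards1 addnC leq_add2r.
  rewrite (_ : [set Z | _] = [set ~: D | D in G]) ?leq_imset_card //.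
  apply/setP => Z; rewrite inE; apply/idP/imsetP => [ZG|[D DG ->]].
    by exists (~: Z); rewrite ?setCK.
  by rewrite setCK.
suff : 2 * #|N| <= #|P| by lia.
rewrite -[#|P|]sum1_card (partition_big (fun p => p.1 :|: p.2) xpredT) //=.
rewrite mulnC -sum_nat_const big_mkcond /=; apply: leq_sum => Z _.
case: ifP => //; rewrite !inE negb_or => /andP[Z0 ZG].
have [D [E [DG EG dDE ZE]]] := cov Z ZG.
have DE : D != E.
  apply: contra Z0 => /eqP eDE; move: dDE; rewrite ZE eDE -setI_eq0 setIid => /eqP ->.
  by rewrite setU0.
rewrite (bigD1 (D, E)) ?inE /= ?DG ?EG ?dDE ?ZE ?eqxx //=.
rewrite (bigD1 (E, D)) ?inE /= ?DG ?EG 1?disjoint_sym ?dDE ?(setUC E) ?eqxx //=.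
by rewrite xpair_eqE negb_and [E == D]eq_sym DE.
Qed.

(** Dividing [cut] by [(2 * M) ^ 2] gives [E] at least [(M - 2) ^ 2] minus a triangle term. The
    triangle term and the loss [4 * M] from the square are each at most [M ^ 2 / (2 * R ^ 2)]. *)
Lemma cut_density R M m e E T :
    1 < M -> m <= 2 * M -> 8 * R ^ 2 <= M -> T * (8 * R ^ 2) <= m ^ 3 ->
    2 * M * (M - 2) <= e -> e ^ 2 <= m ^ 2 * E + m * T ->
  R ^ 2 * M ^ 2 <= R ^ 2 * E + M ^ 2.
Proof.
move: (R ^ 2) => {}R M1 mM RM Tm eM cut.
have : (2 * M) ^ 2 * (8 * R * (M - 2) ^ 2) <= (2 * M) ^ 2 * (8 * R * E + (2 * M) ^ 2).
  rewrite mulnCA -expnMn.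
  apply: leq_trans (_ : 8 * R * e ^ 2 <= _).
    by rewrite leq_mul2l leq_exp2r ?eM ?orbT.
  apply: leq_trans (leq_mul (leqnn _) cut) _.
  apply: leq_trans (_ : m ^ 2 * (8 * R * E + m ^ 2) <= _); last first.
    by rewrite leq_mul ?leq_add2l ?leq_exp2r.
  have /(leq_mul (leqnn m)) := Tm.
  by rewrite -[m ^ 3]/(m * (m * m)) -!mulnn; lia.
rewrite leq_pmul2l; last by rewrite expn_gt0 muln_gt0 /= ltnW.
move: (subnKC M1) => EM; move: (M - 2) EM RM => N <-.
rewrite -!mulnn => RM; have := leq_mul RM (leqnn (2 + N)); lia.
Qed.

Lemma small_cover_structure (X : finType) k (G : {set {set X}}) :
    #|X| = k.*2 -> 6 <= k ->
    3 * (8 * (32 * #|X|) ^ 2) ^ 512 <= 2 ^ (#|X| %/ 3) ->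
    (forall D E : {set X}, D \subset E -> E \in G -> D \in G) ->
    (forall Z, ~: Z \notin G -> exists D E,
       [/\ D \in G, E \in G, [disjoint D & E] & Z = D :|: E]) ->
    #|G| + 3 <= 2 * 2 ^ k ->
  exists2 S : {set X}, #|S| = k &
    G = [set D : {set X} | D \proper S] :|: [set D : {set X} | D \proper ~: S].
Proof.
(* [q] is [8 * R ^ 2], where [R = 32 * #|X|] is the heaviness parameter of [localization]. *)
move=> Xk k6 large down cov Gs; set q := 8 * _ in large.
set M := 2 ^ k in Gs; set r := @disj X.
have M2 : 2 ^ #|X| = M ^ 2 by rewrite Xk -muln2 expnM.
have M4 : 4 <= M by rewrite -[4]/(2 ^ 2) leq_exp2l //; lia.
have M1 : 1 < M by lia.
have qM : q <= M.
  apply: leq_trans (_ : 3 * q ^ 512 <= _).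
    apply: leq_trans (leq_pmull _ (isT : 0 < 3)).
    by rewrite (expnS q 511) leq_pmulr // expn_gt0 /q /= !muln_gt0 Xk double_gt0 /=; lia.
  by apply: leq_trans large _; rewrite leq_exp2l // Xk; lia.
have few b b1 lb := @few_disjoint_triples X b q b1 lb large.
clear large.
pose a (U : {set X}) : nat := U \in G.
have suma (f : {set X} -> nat) : \sum_(U in G) f U = \sum_U a U * f U.
  by rewrite big_mkcond; apply: eq_bigr => U _; rewrite /a; case: ifP; lia.
have massa : mass a = #|G|.
  by rewrite -sum1_card suma; apply: eq_bigr => U _; rewrite muln1.
have tria : disjoint_triples a a a = triangles r G.
  rewrite /triangles suma; apply: eq_bigr => U _; rewrite suma big_distrr.
  apply: eq_bigr => V _; rewrite suma !big_distrr; apply: eq_bigr => W _ /=.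
  by rewrite /r /disj; lia.
have e_lb : 2 * M * (M - 2) <= edges r G G.
  by have := edges_disj_lower cov; rewrite M2 -/r -mulnn mulnBr; lia.
have e_ub : edges r G G <= #|G| ^ 2.
  rewrite -mulnn -{2}sum1_card big_distrr /=; apply: leq_sum => D _.
  by rewrite muln1 -sum1_card; apply: leq_sum => E _; exact: leq_b1.
have Ma : 2 ^ #|X| <= mass a ^ 2.
  rewrite M2 massa; apply: leq_trans e_ub; apply: leq_trans e_lb.
  by rewrite -mulnn [2 * M]mulnC -mulnA leq_mul2l; apply/orP; right; lia.
have Tq : triangles r G * q <= #|G| ^ 3.
  by rewrite -tria -massa; apply: few => // U; exact: leq_b1.
have rC : symmetric r by move=> D E; rewrite /r /disj disjoint_sym.
have [A AG cut] := dense_cut G rC.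
have GM : #|G| <= 2 * M by lia.
have dens := cut_density M1 GM qM Tq e_lb cut.
have AB : #|A| + #|G :\: A| <= 2 * M.
  by apply: leq_trans GM; rewrite -(cardsID A G) (setIidPr AG).
have [S [Sk dS dC]] := localization Xk (leq_trans (isT : 0 < 6) k6) AB dens.
exists S => //; apply: (@linked_cubes_structure X k) => //.
- by move=> Z /cov[D [E [DG EG _ ->]]]; exists D, E.
- apply: leq_trans dS _; rewrite leq_mul2l subset_leq_card //.
  by apply/subsetP => D; rewrite !inE => /andP[/(subsetP AG) -> ->].
- apply: leq_trans dC _; rewrite leq_mul2l subset_leq_card //.
  by apply/subsetP => D; rewrite !inE => /andP[/andP[_ ->] ->].
Qed.

(** * Consequences of maximality *)

Section MaximalThreeWise.

Variables (n : nat) (F : {set {set 'I_n}}).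
Implicit Types A B C D E Z : {set 'I_n}.
Hypothesis maxF : maximal_kwise_intersecting 3 F.

Lemma three_common A B C : A \in F -> B \in F -> C \in F ->
  A :&: B :&: C != set0.
Proof.
move=> AF BF CF; have [|| x xABC] := maxF.1 [set A; B; C].
- by rewrite !subUset !sub1set AF BF.
- by rewrite -setUA cardsU1 cards2; do 2!case: (_ \in _) || case: eqP.
by apply/set0Pn; exists x; rewrite !inE !xABC // !inE eqxx ?orbT.
Qed.

Lemma setT_maximal : setT \in F.
Proof.
apply/negPn/negP => TF; apply: (maxF.2 _ TF) => H HF cH.
have [|| x xH] := maxF.1 (H :\ setT).
- by rewrite subDset.
- exact: leq_trans (subset_leq_card (subsetDl _ _)) cH.
exists x => A AH; have [->|AT] := eqVneq A setT; first by rewrite inE.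
by apply: xH; rewrite !inE AT.
Qed.

(** A violation created by adding [Z] involves [Z] and at most two members of [F]; the pair is
    completed by repetition or by [setT]. *)
Lemma maximal_blocked Z : Z \notin F ->
  exists B C, [/\ B \in F, C \in F & Z :&: B :&: C = set0].
Proof.
move=> ZF; have TF := setT_maximal.
have [/existsP[B /andP[BF /existsP[C /andP[CF /eqP e]]]]|none] :=
  boolP [exists B in F, exists C in F, Z :&: B :&: C == set0].
  by exists B, C.
exfalso; apply: (maxF.2 _ ZF) => H HF cH.
have HZF : H :\ Z \subset F by rewrite subDset.
have [ZH|ZH] := boolP (Z \in H); last first.
  apply: maxF.1 cH; apply/subsetP => A AH; have := subsetP HF A AH.
  by rewrite !inE; case: eqVneq AH => [->|//]; rewrite (negbTE ZH).
have cHZ : #|H :\ Z| <= 2 by move: cH; rewrite (cardsD1 Z H) ZH.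
have [B [C [BF CF HBC]]] : exists B C,
    [/\ B \in F, C \in F & forall A, A \in H :\ Z -> A = B \/ A = C].
  move: cHZ; rewrite leq_eqVlt => /orP[/cards2P[B [C [_ e]]]|].
    exists B, C; split; try by apply: (subsetP HZF); rewrite e !inE eqxx ?orbT.
    by move=> A; rewrite e !inE => /orP[] /eqP ->; [left | right].
  rewrite ltnS leq_eqVlt => /orP[/cards1P[B e]|].
    exists B, B; split; try by apply: (subsetP HZF); rewrite e inE eqxx.
    by move=> A; rewrite e inE => /eqP ->; left.
  rewrite ltnS leqn0 cards_eq0 => /eqP e.
  by exists setT, setT; split=> // A; rewrite e inE.
have /set0Pn[x] : Z :&: B :&: C != set0.
  move: none; rewrite negb_exists => /forallP/(_ B); rewrite BF /=.
  by rewrite negb_exists => /forallP/(_ C); rewrite CF.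
rewrite !inE => /andP[/andP[xZ xB] xC]; exists x => A AH.
have [->//|AZ] := eqVneq A Z.
by have [|->|->] // := HBC A; rewrite !inE AZ.
Qed.

Lemma maximal_up A B : A \subset B -> A \in F -> B \in F.
Proof.
move=> AB AF; apply/negPn/negP => /maximal_blocked[C [D [CF DF e]]].
have := three_common AF CF DF; rewrite -subset0 -e => /negP; apply.
by rewrite !setSI.
Qed.

(** For [B], [C] blocking [Z], the parts [Z :\: B] and [Z :&: B] have complements containing [B] and
    [C] respectively. *)
Lemma maximal_split Z : Z \notin F -> exists D E,
  [/\ ~: D \in F, ~: E \in F, [disjoint D & E] & Z = D :|: E].
Proof.
move=> /maximal_blocked[B [C [BF CF e]]]; exists (Z :\: B), (Z :&: B); split.
- by apply: maximal_up BF; rewrite -setCS setCK setDE subsetIr.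
- apply: maximal_up CF; rewrite -setCS setCK.
  by rewrite -disjoints_subset -setI_eq0 e.
- by rewrite disjoint_sym disjoints_subset setCD subsetU // subsetIr orbT.
- by rewrite setUC setID.
Qed.

End MaximalThreeWise.

(** * Passage to complements and choice of the threshold *)

Theorem theorem1p1 :
  exists n0 : nat, forall n : nat, ~~ odd n -> n0 <= n ->
    forall F : {set {set 'I_n}},
      maximal_kwise_intersecting 3 F ->
      #|F| + 3 <= 2 ^ (n./2 + 1) ->
      balanced_linked_cubes F.
Proof.
(* The polynomial is [3 * q ^ 512] for [q = 8 * (32 * n) ^ 2]; the 12 below ensures [6 <= n./2]. *)
have [n1 n1P] := poly_leq_exp (3 * (8 * 32 ^ 2) ^ 512) (2 * 512) (isT : 0 < 3).
exists (maxn 12 n1) => n evn; rewrite geq_max => /andP[n12 /n1P large] F maxF cF.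
have nE : n = n./2.*2 by rewrite -[LHS]odd_double_half (negbTE evn).
pose G := [set D : {set 'I_n} | ~: D \in F].
have cG : #|G| = #|F|.
  rewrite -(card_preimset F (inv_inj (@setCK _))).
  by apply: eq_card => D; rewrite !inE.
have [||||||S Sk GE] := @small_cover_structure 'I_n n./2 G.
- by rewrite card_ord.
- exact: half_leq n12.
- rewrite card_ord; move: large; rewrite expnM -mulnA -expnMn.
  by rewrite -mulnA -expnMn.
- move=> D E DE; rewrite !inE; apply: maximal_up => //; by rewrite setCS.
- move=> Z; rewrite inE setCK => /(maximal_split maxF)[D [E [DF EF dDE ZE]]].
  by exists D, E; split; rewrite // inE.
- by rewrite cG -expnS; move: cF; rewrite addn1.
exists S; split; first by rewrite Sk leqnn uphalf_half leq_addl.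
apply/setP => A; have /setP/(_ (~: A)) := GE; rewrite !inE setCK => ->.
have properC (P : {set 'I_n}) : (~: A \proper P) = (~: P \proper A).
  by rewrite !properE -[~: A \subset P]setCS -[P \subset ~: A]setCS !setCK.
by rewrite !properC setCK orbC.
Qed.
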